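(* Let $R$ be a semiprime ring, let $I$ be a nonzero ideal of $R$, and let $d:R\to R$ be a multiplicative semiderivation associated with a nonzero epimorphism $g$ of $R$. If $d$ acts as an anti-homomorphism on $I$, i.e. $d(xy)=d(y)d(x)$ for all $x,y\in I$, then $[x,d(x)]=0$ for all $x\in I$.
   Context: Rings are associative and not assumed unital or commutative; ideals are two-sided. A ring $R$ is semiprime if for $x\in R$, $xRx=0$ implies $x=0$. For $x,y\in R$, $[x,y]=xy-yx$. A mapping $d:R\to R$ (not assumed additive) is a multiplicative semiderivation associated with a function $g:R\to R$ if (i) $d(xy)=d(x)g(y)+xd(y)=d(x)y+g(x)d(y)$ and (ii) $d(g(x))=g(d(x))$ hold for all $x,y\in R$. An epimorphism of $R$ is a surjective ring homomorphism $R\to R$; nonzero means not the zero map. *)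

(* Defs.v *)
From HB Require Import structures.
From mathcomp Require Import all_boot all_order all_algebra.
Set Implicit Arguments.
Unset Strict Implicit.
Unset Printing Implicit Defensive.

Import GRing.Theory.

Local Open Scope ring_scope.

(* In ring_scope [x * y] is GRing.mul, which lives in rings with a unit;
   [x ** y] is the multiplication of a mere semigroup. *)
Notation "x ** y" := (x * y)%g (at level 40, left associativity) : ring_scope.

(* GRing.PzRing and its descendants require a unit, hence this structure.
   The zero ring is allowed. *)
HB.mixin Record Zmodule_Semigroup_isRng R
    of GRing.Zmodule R & Semigroup R := {
  rngMDl : forall x y z : R, (x + y) ** z = x ** z + y ** z;
  rngMDr : forall x y z : R, x ** (y + z) = x ** y + x ** z
}.

#[short(type="rngType")]
HB.structure Definition Rng :=
  {R of Zmodule_Semigroup_isRng R & GRing.Zmodule R & Semigroup R}.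

HB.structure Definition RngMorphism (R S : rngType) :=
  {f of @GRing.Additive R S f & @Multiplicative R S f}.

Notation "{ 'rngmorphism' R -> S }" := (RngMorphism.type R%type S%type)
  (at level 0, R at level 98, S at level 99,
   format "{ 'rngmorphism'  R  ->  S }") : type_scope.

Definition surjective (T U : Type) (f : T -> U) : Prop :=
  forall y, exists x, f x = y.

Section RngNotions.
Variable R : rngType.
Implicit Types (I : R -> Prop) (d g : R -> R).

Definition semiprime : Prop :=
  forall x : R, (forall r : R, x ** r ** x = 0) -> x = 0.

(* The ring commutator, not the group commutator [~ x, y]. *)
Definition lie (x y : R) : R := x ** y - y ** x.

Definition two_sided_ideal I : Prop :=
  [/\ I 0,
      forall x y, I x -> I y -> I (x - y)
    & forall r x, I x -> I (r ** x) /\ I (x ** r)].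

Definition mult_semiderivation d g : Prop :=
  [/\ forall x y, d (x ** y) = d x ** g y + x ** d y,
      forall x y, d (x ** y) = d x ** y + g x ** d y
    & forall x, d (g x) = g (d x)].

Definition antihom_on I d : Prop :=
  forall x y, I x -> I y -> d (x ** y) = d y ** d x.

End RngNotions.

Arguments semiprime R : clear implicits.

(* Main.v *)
(* Expanding d((xy)y) = d(y)d(xy) on both sides cancels every occurrence of g and
   leaves xy d(y) = d(y) x d(y) for x, y in I.  Comparing this identity at rx with
   its left multiple by r gives [r, d(y)] x d(y) = 0, so c = [y, d(y)] satisfies
   c I c I = 0.  Semiprimeness then gives c I = 0, and as c lies in I, c = 0. *)
Require Import Defs.
From HB Require Import structures.
From mathcomp Require Import all_boot all_order all_algebra.
Set Implicit Arguments.
Unset Strict Implicit.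
Unset Printing Implicit Defensive.
Local Open Scope ring_scope.

Import GRing.Theory.

Section RngTheory.
Variable R : rngType.
Implicit Types (x y z : R) (I : R -> Prop) (d g : R -> R).

Lemma rng_mul0l x : 0 ** x = 0.
Proof. by apply: (addrI (0 ** x)); rewrite -rngMDl !addr0. Qed.

Lemma rng_mul0r x : x ** 0 = 0.
Proof. by apply: (addrI (x ** 0)); rewrite -rngMDr !addr0. Qed.

Lemma rng_mulNl x y : (- x) ** y = - (x ** y).
Proof. by apply: (addrI (x ** y)); rewrite -rngMDl !subrr rng_mul0l. Qed.

Lemma rng_mulNr x y : x ** (- y) = - (x ** y).
Proof. by apply: (addrI (x ** y)); rewrite -rngMDr !subrr rng_mul0r. Qed.

Lemma rng_mulBl x y z : (x - y) ** z = x ** z - y ** z.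
Proof. by rewrite rngMDl rng_mulNl. Qed.

Lemma rng_mulBr x y z : x ** (y - z) = x ** y - x ** z.
Proof. by rewrite rngMDr rng_mulNr. Qed.

Lemma antihom_semider_mul I d g : two_sided_ideal I ->
    mult_semiderivation d g -> antihom_on I d ->
  forall x y, I x -> I y -> x ** y ** d y = d y ** x ** d y.
Proof.
move=> [_ _ I_mul] [dMg _ _] d_anti x y Ix Iy.
have Ixy : I (x ** y) by case: (I_mul x y Iy).
(* With this summand added, both sides expand [d (x ** y ** y)]: the left by the product rule, since
   [d y ** d x] is [d (x ** y)], the right as [d y ** d (x ** y)]. *)
apply: (addrI (d y ** d x ** g y)).
rewrite -{1}(d_anti x y Ix Iy) -dMg d_anti // dMg rngMDr.
by rewrite !mulgA.
Qed.

Lemma antihom_semider_lie_mul I d g : two_sided_ideal I ->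
    mult_semiderivation d g -> antihom_on I d ->
  forall r x y, I x -> I y -> lie r (d y) ** x ** d y = 0.
Proof.
move=> I_ideal d_semi d_anti r x y Ix Iy; have [_ _ I_mul] := I_ideal.
have key := antihom_semider_mul I_ideal d_semi d_anti.
have Irx : I (r ** x) by case: (I_mul r x Ix).
rewrite /lie !rng_mulBl -(mulgA (d y)) -key // -!mulgA [d y ** _]mulgA.
by rewrite -key // !mulgA subrr.
Qed.

(** Semiprimeness is used twice: first at [x ** i], so that [x] kills [I] from the left, then at [x]
    itself, because [r ** x] lies in [I]. *)
Lemma semiprime_ideal_annl I x : semiprime R -> two_sided_ideal I -> I x ->
  (forall i r, I i -> x ** i ** r ** x ** i = 0) -> x = 0.
Proof.
move=> R_semiprime [_ _ I_mul] Ix xIx.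
have xI i : I i -> x ** i = 0.
  by move=> Ii; apply: R_semiprime => r; rewrite !mulgA xIx.
by apply: R_semiprime => r; rewrite -mulgA xI //; case: (I_mul r x Ix).
Qed.

End RngTheory.

Theorem theorem8 (R : rngType) (I : R -> Prop) (d : R -> R)
    (g : {rngmorphism R -> R})
    (R_semiprime : semiprime R)
    (I_ideal : two_sided_ideal I)
    (I_neq0 : exists x, I x /\ x <> 0)
    (g_epi : surjective g)
    (g_neq0 : exists x, g x <> 0)
    (d_semider : mult_semiderivation d g)
    (d_antihom : antihom_on I d) :
  forall x, I x -> lie x (d x) = 0.
Proof.
move=> x Ix; have [_ IB I_mul] := I_ideal.
have ann := antihom_semider_lie_mul I_ideal d_semider d_antihom x.
apply: (semiprime_ideal_annl R_semiprime I_ideal) => [|i r Ii].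
  by have [? ?] := I_mul (d x) x Ix; apply: IB.
have [_ Iir] := I_mul r i Ii; have [Iirx _] := I_mul (i ** r) x Ix.
(* Only the second commutator is expanded; the first stays as the left factor needed by [ann]. One
   resulting term vanishes by [ann] at [i ** r ** x], the other by [ann] at [i ** r], both elements
   of [I]. *)
rewrite {2}/lie rng_mulBr rng_mulBl !mulgA.
have -> : lie x (d x) ** i ** r ** x ** d x = 0.
  by have := ann _ _ Iirx Ix; rewrite !mulgA.
have -> : lie x (d x) ** i ** r ** d x = 0.
  by have := ann _ _ Iir Ix; rewrite !mulgA.
by rewrite !rng_mul0l subrr.
Qed.
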